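(* Let $s\ge g\ge 3$ and let $V$ be the set of $s^2$ treatments of a pseudo-$L_g(s)$ association scheme. Suppose there are $g$ partitions $\mathcal P_1,\dots,\mathcal P_g$ of $V$, where $\mathcal P_i=\{B^i_1,\dots,B^i_s\}$ consists of $s$ pairwise disjoint cliques. Then the following are equivalent: (A) for any $i\neq j$ in $\{1,\dots,g\}$ and any $m,n\in\{1,\dots,s\}$, $B^i_m$ and $B^j_n$ have exactly one common treatment; (B) for every treatment $t\in V$ there exist pairwise disjoint sets $A_1,\dots,A_g$, each of cardinality $s-1$, whose union is the set of all first associates of $t$, such that each $\{t\}\cup A_k$ is a clique, and such that for each $i=1,\dots,g$ the block $B^i_{m_i}$ of $\mathcal P_i$ containing $t$ equals $\{t\}\cup A_{k_i}$ for some $k_i\in\{1,\dots,g\}$, where $i\mapsto k_i$ is a bijection of $\{1,\dots,g\}$.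
   Context: An association scheme with two associate classes on $v$ treatments is a symmetric relation splitting every pair of distinct treatments into first or second associates such that each treatment has $n_i$ $i$-th associates and for two $i$-th associates the number of treatments that are $j$-th associates of the first and $k$-th associates of the second is a constant $p^i_{jk}$. A pseudo-$L_g(s)$ association scheme has $v=s^2$, $n_1=g(s-1)$, $p^1_{11}=(s-2)+(g-1)(g-2)$, $p^2_{11}=g(g-1)$. A clique is a set of treatments any two distinct of which are first associates. *)

(* Defs.v *)
From mathcomp Require Import all_boot.

Set Implicit Arguments.
Unset Strict Implicit.
Unset Printing Implicit Defensive.

Inductive assoc_class := First | Second.

(* Association scheme with two associate classes on the treatments [T].  The
   parameters are fields: [valency S i] is n_i, [pnum S i j k] is p^i_{jk}. *)
Record assoc_scheme2 (T : finType) := AssocScheme2 {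
  assoc : assoc_class -> rel T;
  valency : assoc_class -> nat;
  pnum : assoc_class -> assoc_class -> assoc_class -> nat;
  assoc_irr : forall i, irreflexive (assoc i);
  assoc_sym : forall i, symmetric (assoc i);
  assoc_split : forall x y, x != y -> assoc First x y (+) assoc Second x y;
  assoc_valency : forall i x, #|[set y | assoc i x y]| = valency i;
  assoc_pnum : forall i j k x y, assoc i x y ->
    #|[set z | assoc j x z & assoc k y z]| = pnum i j k
}.

Definition associates (T : finType) (S : assoc_scheme2 T) (i : assoc_class)
    (t : T) : {set T} := [set x | assoc S i t x].

Definition is_clique (T : finType) (S : assoc_scheme2 T) (C : {set T}) : Prop :=
  {in C &, forall x y, x != y -> assoc S First x y}.

(* The subtractions are the ordinary ones as soon as 2 <= s and 2 <= g. *)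
Definition pseudo_L (T : finType) (g s : nat) (S : assoc_scheme2 T) : Prop :=
  [/\ #|T| = s ^ 2,
      valency S First = g * (s - 1),
      pnum S First First First = (s - 2) + (g - 1) * (g - 2)
    & pnum S Second First First = g * (g - 1)].

(* Injectivity makes the [s] blocks of the partition pairwise distinct, hence
   disjoint; [partition] alone only concerns the set of values of [B]. *)
Definition labelled_partition (T : finType) (s : nat) (B : 'I_s -> {set T}) :
    Prop :=
  partition [set B m | m : 'I_s] [set: T] /\ injective B.

(* Main.v *)
(** Both conditions force every block to have [s] treatments.  Assuming (A), a
    block is cut into [s] singletons by any other partition, and the punctured
    blocks through [t] are [g] disjoint sets of size [s - 1] inside the
    [g * (s - 1)] first associates of [t], so they exhaust them.  Assuming (B),
    two blocks from different partitions share at most one treatment; as the [s]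
    blocks of one partition cut each block of the other into [s] treatments in
    total, they share exactly one. *)
Require Import Defs.
From mathcomp Require Import all_boot.

Set Implicit Arguments.
Unset Strict Implicit.
Unset Printing Implicit Defensive.

Lemma card_disjoint_bigcup (I T : finType) (F : I -> {set T}) :
  (forall i j, i != j -> [disjoint F i & F j]) ->
  #|\bigcup_i F i| = \sum_i #|F i|.
Proof.
move=> dF; rewrite -sum1_card partition_disjoint_bigcup //.
by apply: eq_bigr => i _; rewrite sum1_card.
Qed.

Lemma labelled_partition_ex (T : finType) (s : nat) (B : 'I_s -> {set T}) x :
  labelled_partition B -> exists m, x \in B m.
Proof.
move=> [/cover_partition covB _].
have: x \in cover [set B m | m : 'I_s] by rewrite covB inE.
by case/bigcupP => _ /imsetP[m _ ->] xB; exists m.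
Qed.

Lemma labelled_partition_disjoint (T : finType) (s : nat)
    (B : 'I_s -> {set T}) m n :
  labelled_partition B -> m != n -> [disjoint B m & B n].
Proof.
move=> [/partition_trivIset/trivIsetP dB injB] mn.
by apply: dB; rewrite ?imset_f ?(inj_eq injB).
Qed.

Lemma labelled_partition_pblock (T : finType) (s : nat)
    (B : 'I_s -> {set T}) m x :
  labelled_partition B -> x \in B m -> pblock [set B n | n : 'I_s] x = B m.
Proof.
by move=> [/partition_trivIset tI _]; apply: def_pblock; rewrite ?imset_f.
Qed.

Lemma card_labelled_partition (T : finType) (s : nat) (B : 'I_s -> {set T})
    (C : {set T}) :
  labelled_partition B -> #|C| = \sum_m #|C :&: B m|.
Proof.
move=> pB; rewrite -card_disjoint_bigcup => [|m n mn].
  apply: eq_card => x; apply/idP/bigcupP => [xC | [m _ /setIP[] //]].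
  by have [m xB] := labelled_partition_ex x pB; exists m; rewrite // inE xC.
have := labelled_partition_disjoint pB mn.
rewrite -!setI_eq0 => /eqP dB; apply/eqP/setP => x; move/setP/(_ x): dB.
by rewrite !inE andbACA andbb => ->; rewrite andbF.
Qed.

(** Equality case of the termwise bound: the sum reaches its maximum, so no term can fall below
    1. *)
Lemma sum_ord_le1_eq1 (s : nat) (f : 'I_s -> nat) :
  (forall n, f n <= 1) -> \sum_n f n = s -> forall n, f n = 1.
Proof.
move=> f1 sumf n.
have /leqif_sum [_] : forall i : 'I_s, true -> f i <= 1 ?= iff (f i == 1).
  by move=> i _; split.
by rewrite sumf sum1_card card_ord eqxx => /esym/forallP/(_ n)/eqP.
Qed.

Theorem theorem3p6 (g s : nat) (hg : 3 <= g) (hgs : g <= s)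
    (V : finType) (S : assoc_scheme2 V) (hS : pseudo_L g s S)
    (B : 'I_g -> 'I_s -> {set V})
    (hpart : forall i, labelled_partition (B i))
    (hclique : forall i m, is_clique S (B i m)) :
  (forall i j, i != j -> forall m n, #|B i m :&: B j n| = 1)
  <->
  (forall t : V, exists A : 'I_g -> {set V},
     [/\ forall k l, k != l -> [disjoint A k & A l],
         forall k, #|A k| = s - 1,
         \bigcup_k A k = associates S First t,
         forall k, is_clique S (t |: A k)
       & exists k : 'I_g -> 'I_g, bijective k /\
           forall i m, t \in B i m -> B i m = t |: A (k i)]).
Proof.
case: hS => _ valF _ _; split => [meet1 t | localB i j ij m n].
  have cardB i m : #|B i m| = s.
    (* As [g] is at least 2, index 0 or index 1 differs from [i]. *)
    have [j ij] : exists j, i != j.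
      have [i0 | i0] := eqVneq i (Ordinal (ltnW (ltnW hg))).
        by exists (Ordinal (ltnW hg)); rewrite i0.
      by exists (Ordinal (ltnW (ltnW hg))).
    rewrite (card_labelled_partition (B i m) (hpart j)).
    by rewrite (eq_bigr _ (fun n _ => meet1 i j ij m n)) sum1_card card_ord.
  (* [pblock] yields the block through [t] as a function of [i], without choosing labels [m]. *)
  pose Bt i := pblock [set B i m | m : 'I_s] t.
  have BtE i m : t \in B i m -> Bt i = B i m.
    exact: labelled_partition_pblock.
  have BtP i : exists2 m, t \in B i m & Bt i = B i m.
    by have [m tB] := labelled_partition_ex t (hpart i); exists m; auto.
  have tBt i : t \in Bt i by have [m tB ->] := BtP i.
  have disjA k l : k != l -> [disjoint Bt k :\ t & Bt l :\ t].
    have [[m tm ->] [n tn ->]] := (BtP k, BtP l) => kl.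
    have /eqP/cards1P [x Ex] := meet1 k l kl m n.
    (* Both blocks contain [t], so it is their only common treatment; removing it leaves disjoint
       sets. *)
    have /setP tx : [set t] = B k m :&: B l n.
      by move: (in_setI t (B k m) (B l n)); rewrite Ex tm tn inE => /eqP->.
    rewrite -setI_eq0; apply/eqP/setP => y; have := tx y; rewrite !inE.
    by case: (y == t) => //= <-.
  have cardA k : #|Bt k :\ t| = s - 1.
    have [m tm E] := BtP k.
    by rewrite -(cardB k m) -E (cardsD1 t (Bt k)) tBt addKn.
  exists (fun i => Bt i :\ t); split=> // [|k|].
  (* Inclusion holds because the blocks are cliques containing [t]; counting against
     [valency S First] gives equality. *)
  - apply/eqP; rewrite eqEcard; apply/andP; split.
      apply/bigcupsP => k _; apply/subsetP => y; rewrite !inE.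
      have [m tm ->] := BtP k => /andP[yt yB].
      by apply: (hclique k m); rewrite // eq_sym.
    rewrite card_disjoint_bigcup // (eq_bigr _ (fun k _ => cardA k)).
    by rewrite sum_nat_const card_ord -valF assoc_valency.
  - by have [m _ E] := BtP k; rewrite setD1K // E.
  - exists id; split; first by exists id.
    by move=> i m /BtE <-; rewrite setD1K.
have cardB : #|B i m| = s.
  (* (B) must be applied at a treatment of the block; one exists since a partition has no empty
     block. *)
  have [t tB] : exists t, t \in B i m.
    have [/partition0 n0 _] := hpart i.
    by apply/set0Pn/eqP => B0; move: n0; rewrite -B0 imset_f.
  have [A [_ cardA UA _ [k [_ /(_ i m tB) ->]]]] := localB t.
  have tA : t \notin A (k i).
    apply/negP => tA; have : t \in \bigcup_k A k by apply/bigcupP; exists (k i).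
    by rewrite UA inE assoc_irr.
  (* Truncated subtraction: [1 + (s - 1) = s] requires [1 <= s], which follows from
     [3 <= g <= s]. *)
  by rewrite cardsU1 tA cardA subnKC // (leq_trans _ hgs) // ltnW // ltnW.
apply: (sum_ord_le1_eq1 (f := fun n => #|B i m :&: B j n|)) => [{}n|].
  have [-> | [t /setIP[ti tj]]] := set_0Vmem (B i m :&: B j n).
    by rewrite cards0.
  have [A [disjA _ _ _ [k [/bij_inj injk kB]]]] := localB t.
  (* Injectivity of [k] makes the two punctured blocks disjoint, so the blocks meet only in [t]. *)
  have := disjA (k i) (k j); rewrite (inj_eq injk) => /(_ ij).
  rewrite -setI_eq0 (kB _ _ ti) (kB _ _ tj) -setUIr => /eqP->.
  by rewrite setU0 cards1.
by rewrite -card_labelled_partition.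
Qed.
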